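(* Let $g$ be a disjunctive sum of finitely many BIPASS strips, played under the misère convention (a player who cannot move wins). If $\Delta(g)\ge 2$, then Left wins $g$, regardless of who starts.
   Context: **BIPASS.** A strip is a finite word over $\{B,W\}$ ($B$ = black stone, $W$ = white stone). Dead stones are removed immediately: a white stone with no black stone to its left, and a black stone with no white stone to its right, are deleted. So a strip is either the empty word (no moves) or a word beginning with $B$ and ending with $W$. A Left move chooses a black stone at position $i$ and a white stone at position $j>i$ with no black stone strictly between them, and interchanges the two; a Right move chooses a black stone at position $i$ and a white stone at position $j>i$ with no white stone strictly between them, and interchanges the two. After a move, dead stones (all leading $W$'s and all trailing $B$'s) are deleted. In a disjunctive sum, the player to move makes a move in exactly one strip. For a strip $s$, $\Delta(s)=w(s)-b(s)$ (number of white stones minus number of black stones), and $\Delta$ is additive over disjunctive sums of strips. *)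

(* Defs.v *)
From HB Require Import structures.
From mathcomp Require Import all_boot all_order all_algebra.

Set Implicit Arguments.
Unset Strict Implicit.
Unset Printing Implicit Defensive.

Import Order.TTheory GRing.Theory Num.Theory.

Variant player : Type := Left | Right.

Definition opponent (p : player) : player :=
  if p is Left then Right else Left.

(* [misere_first move p g] : p wins g when p is to move.
   [misere_second move p g] : p wins g when the opponent is to move; the
   existence of a move h is required since an opponent who cannot move wins.
   As least fixpoints, these only count plays that end after finitely many
   moves, which is every play of BIPASS. *)
Inductive misere_first (P : Type) (move : player -> P -> P -> Prop)
    (p : player) (g : P) : Prop :=
| misere_stuck of (forall h, ~ move p g h)
| misere_move h of move p g h & misere_second move p h
with misere_second (P : Type) (move : player -> P -> P -> Prop)
    (p : player) (g : P) : Prop :=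
| misere_reply h of move (opponent p) g h
    & (forall h', move (opponent p) g h' -> misere_first move p h').

Variant stone : Type := B | W.

Definition bool_of_stone (c : stone) : bool := if c is W then true else false.
Definition stone_of_bool (b : bool) : stone := if b then W else B.
Lemma bool_of_stoneK : cancel bool_of_stone stone_of_bool.
Proof. by case. Qed.
HB.instance Definition _ := Equality.copy stone (can_type bool_of_stoneK).

Definition word : Type := seq stone.

(* Words without dead stones. *)
Definition is_strip (s : word) : bool :=
  (s == [::]) || (head W s == B) && (last B s == W).

Definition drop_leading (c : stone) (s : word) : word :=
  drop (find (predC1 c) s) s.

(* Leading W's are exactly the whites with no black to their left, trailing
   B's exactly the blacks with no white to their right. *)
Definition remove_dead (s : word) : word :=
  rev (drop_leading B (rev (drop_leading W s))).

Definition swap_stones (i j : nat) (s : word) : word :=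
  set_nth B (set_nth B s i (nth B s j)) j (nth B s i).

Definition own_stone (p : player) : stone := if p is Left then B else W.

Definition strip_move (p : player) (s t : word) : Prop :=
  exists i j : nat,
    [/\ i < j < size s,
        nth B s i = B,
        nth B s j = W,
        forall k, i < k < j -> nth B s k <> own_stone p
      & t = remove_dead (swap_stones i j s)].

(* A disjunctive sum is the sequence of its components. *)
Definition sum_move (p : player) (g h : seq word) : Prop :=
  exists k t,
    [/\ k < size g, strip_move p (nth [::] g k) t & h = set_nth [::] g k t].

Definition strip_delta (s : word) : int :=
  ((count_mem W s)%:Z - (count_mem B s)%:Z)%R.

Definition delta (g : seq word) : int := (\sum_(s <- g) strip_delta s)%R.

(* Main.v *)
Require Import Defs.
From mathcomp Require Import all_boot all_order all_algebra.
From mathcomp Require Import zify.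

(** Write w and b for the total numbers of white and black stones of a sum, so
    that its delta is w - b, and call a strip thin when it has at most one black
    stone; nonempty thin strips have the form BWW...W.

    Left keeps the invariant that, with Right to move, either w - b >= 2 or all
    strips are thin and w is odd ([good_right]).  Right can then move, and a
    move of Right lowers w - b by at most 1, since at most one white stone dies
    at the front; from a thin strip it removes exactly one white.  So Left is
    faced with w - b >= 1, or with thin strips and w even ([good_left]).

    If some strip has two or more black stones, then w - b >= 1 and Left moves
    the last black stone of that strip to the end of the strip, where it dies:
    w - b is at least 2 again.  If all strips are thin, only the parity of w
    matters.  When w is even, Left removes a single white stone, or there is
    nothing left to move and Left has won.  When w is odd, w > b yields a strip
    with at least two white stones, from which Left removes two: a black stone
    jumps over as many whites as Left likes, whereas a white stone of a thin
    strip has a single black stone to jump over.  In both cases w is odd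
    afterwards.

    Play ends because each move lowers the number of pairs formed by a black
    stone and a white stone to its right. *)

(** * Moves as rewritings of words *)

Lemma split_nth (T : Type) (x0 : T) (s : seq T) (i : nat) : i < size s ->
  exists u r, s = u ++ nth x0 s i :: r /\ size u = i.
Proof.
move=> lt_is; exists (take i s), (drop i.+1 s).
by rewrite -drop_nth // cat_take_drop size_takel // ltnW.
Qed.

Lemma set_nth_mid (T : Type) (x0 y z : T) (u r : seq T) :
  set_nth x0 (u ++ y :: r) (size u) z = u ++ z :: r.
Proof. by elim: u => //= a u ->. Qed.

Lemma nth_mid (T : Type) (x0 y : T) (u r : seq T) :
  nth x0 (u ++ y :: r) (size u) = y.
Proof. by elim: u. Qed.

Lemma swap_stones_cat (u v r : word) :
  swap_stones (size u) (size u + (size v).+1) (u ++ B :: v ++ W :: r)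
  = u ++ W :: v ++ B :: r.
Proof.
have szE c : size u + (size v).+1 = size (u ++ c :: v) by rewrite size_cat.
have catE c d : u ++ c :: v ++ d :: r = (u ++ c :: v) ++ d :: r.
  by rewrite -catA.
have nthW : nth B (u ++ B :: v ++ W :: r) (size u + (size v).+1) = W.
  by rewrite (szE B) catE nth_mid.
rewrite /swap_stones nth_mid nthW set_nth_mid.
by rewrite (szE W) catE set_nth_mid -catE.
Qed.

(** Cutting a strip around the two exchanged stones replaces positions by
    concatenations, for which stone counts are additive. *)
Lemma strip_moveP (p : player) (s t : word) :
  strip_move p s t <->
  exists u v r, [/\ s = u ++ B :: v ++ W :: r, own_stone p \notin v
                  & t = remove_dead (u ++ W :: v ++ B :: r)].
Proof.
split=> [[i [j [/andP[lt_ij lt_js] si sj btw ->]]] | [u [v [r [-> vp ->]]]]].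
  have [u [q [Es szu]]] := split_nth _ B s i (ltn_trans lt_ij lt_js).
  rewrite si in Es.
  have lt_q : j - i.+1 < size q.
    by move: lt_js; rewrite Es size_cat /=; lia.
  have [v [r [Eq szv]]] := split_nth _ B q _ lt_q.
  have Ej : j = size u + (size v).+1 by lia.
  have Eqj : nth B q (j - i.+1) = W.
    rewrite -sj Es nth_cat ifN; last by lia.
    by rewrite szu (_ : j - i = (j - i.+1).+1); last by lia.
  rewrite Eqj in Eq.
  exists u, v, r; split; first by rewrite Es Eq.
    apply/negP => /(nthP B)[k lt_kv vk].
    have lt_k : k < j - i.+1 by rewrite -szv.
    apply: (btw (i + k.+1)); first by lia.
    rewrite Es Eq -szu nth_cat ifN; last by lia.
    by rewrite addKn /= nth_cat lt_kv.
  by rewrite Ej -szu {1}Es Eq swap_stones_cat.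
exists (size u), (size u + (size v).+1); split.
- by rewrite size_cat /= size_cat /=; lia.
- exact: nth_mid.
- by rewrite nth_cat ifN ?addKn /= ?nth_mid //; lia.
- move=> k lt_k kp; move/negP: vp; apply.
  rewrite -kp nth_cat ifN; last by lia.
  have [k' Ek] : exists k', k - size u = k'.+1 by exists (k - (size u).+1); lia.
  have lt_k' : k' < size v by lia.
  by rewrite Ek /= nth_cat lt_k' mem_nth.
- by rewrite swap_stones_cat.
Qed.

Lemma sum_moveP (p : player) (g h : seq word) :
  sum_move p g h <->
  exists l s t r, [/\ g = l ++ s :: r, strip_move p s t & h = l ++ t :: r].
Proof.
split=> [[k [t [lt_kg mv ->]]] | [l [s [t [r [-> mv ->]]]]]].
  have [l [r [Eg szl]]] := split_nth _ [::] g k lt_kg.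
  exists l, (nth [::] g k), t, r; split=> //.
  by rewrite {1}Eg -szl set_nth_mid.
exists (size l), t; rewrite nth_mid set_nth_mid; split=> //.
by rewrite size_cat /=; lia.
Qed.

(** * Dead stones *)

Lemma drop_leadingE (c : stone) (s : word) :
  exists2 m, s = nseq m c ++ drop_leading c s
           & drop_leading c s = [::] \/ head c (drop_leading c s) != c.
Proof.
elim: s => [|a s [m Es hd]]; first by exists 0; [|left].
rewrite /drop_leading /=; case: eqP => [->|/eqP ne_ac] /=.
  by exists m.+1; rewrite // {1}Es.
by exists 0; [|right].
Qed.

(** The whites at the front have to be known exactly, because their death lowers
    delta; for the blacks at the back it is enough that they exist in some
    number [n], because their death raises delta. *)
Lemma remove_deadE (s : word) :
  exists n, drop_leading W s = remove_dead s ++ nseq n B.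
Proof.
have [n /(congr1 rev) E _] := drop_leadingE B (rev (drop_leading W s)).
by exists n; rewrite revK rev_cat rev_nseq in E.
Qed.

Lemma is_strip_remove_dead (s : word) : is_strip (remove_dead s).
Proof.
have [n E] := remove_deadE s.
have [_ _ hdW] := drop_leadingE W s; rewrite E in hdW.
have [_ _] := drop_leadingE B (rev (drop_leading W s)).
rewrite -[drop_leading B _]revK -/(remove_dead s) => tlB.
rewrite /is_strip; case: eqP => //= ne0.
case: tlB => [/(congr1 rev) /= | ]; first by rewrite revK.
case: hdW => [/nilP|]; first by case: (remove_dead s) ne0.
case/lastP: (remove_dead s) ne0 => // x b _.
rewrite rev_rcons last_rcons /=.
by case: x => [|a x] /=; [case: b | case: a; case: b].
Qed.

(** * Termination *)

(** The number of pairs made of a black stone and a white stone to its right. *)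
Fixpoint inv (s : word) : nat :=
  if s is c :: s' then (if c is B then count_mem W s' else 0) + inv s' else 0.

Lemma inv_cat (s t : word) :
  inv (s ++ t) = inv s + count_mem B s * count_mem W t + inv t.
Proof. by elim: s => //= -[] s ->; rewrite ?count_cat /=; lia. Qed.

(** A leading white or a trailing black belongs to no pair, so in fact equality
    holds. *)
Lemma inv_remove_dead (s : word) : inv (remove_dead s) <= inv s.
Proof.
have [n E] := remove_deadE s; have [m Es _] := drop_leadingE W s.
by rewrite [in inv s]Es E !inv_cat; lia.
Qed.

(** The exchanged stones stop forming a pair, and the stones around and between
    them gain none. *)
Lemma inv_move (p : player) (s t : word) : strip_move p s t -> inv t < inv s.
Proof.
case/strip_moveP=> u [v [r [-> _ ->]]].
apply: leq_ltn_trans (inv_remove_dead _) _.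
by rewrite !inv_cat /= !count_cat /= !inv_cat /=; lia.
Qed.

(** * The effect of a move on a single strip *)

(** Here the first black stone of B W^m x has jumped over the [m] whites behind
    it: exactly these whites die, since the stone itself protects those of [x].
    Trailing blacks of [x] may die as well, hence only a bound for blacks. *)
Lemma count_remove_dead (m : nat) (x : word) :
  let t := remove_dead (nseq m W ++ B :: x) in
  count_mem W t = count_mem W x /\ count_mem B t <= (count_mem B x).+1.
Proof.
have [n] := remove_deadE (nseq m W ++ B :: x).
have -> : drop_leading W (nseq m W ++ B :: x) = B :: x by elim: m.
move=> E; move: (congr1 (count_mem W) E) (congr1 (count_mem B) E).
by rewrite !count_cat !count_nseq /=; lia.
Qed.

Lemma strip_cons (s : word) : is_strip s -> s != [::] ->
  exists2 x, s = B :: x & last B x = W.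
Proof.
rewrite /is_strip => /orP[-> // | ] /andP[].
by case: s => // -[] //= x _ /eqP lx _; exists x.
Qed.

(** An adjacent pair BW has nothing between its stones, so either player may
    exchange it. *)
Lemma has_adjacent_BW (x : word) : last B x = W ->
  exists u r, B :: x = u ++ B :: W :: r.
Proof.
elim: x => [|[] x IHx] //= lx; last by exists [::], x.
by have [u [r ->]] := IHx lx; exists (B :: u), r.
Qed.

Lemma strip_can_move (p : player) (s : word) : is_strip s -> s != [::] ->
  exists t, strip_move p s t.
Proof.
move=> st nz; have [x -> lx] := strip_cons _ st nz.
have [u [r ->]] := has_adjacent_BW _ lx.
exists (remove_dead (u ++ W :: B :: r)); apply/strip_moveP.
by exists u, [::], r.
Qed.

(** Either a black stone precedes the exchanged pair, and no white stone dies, or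
    the white stone jumps to the front over blacks only and is followed by a
    black: then it dies alone. *)
Lemma right_move_delta (s t : word) : is_strip s -> strip_move Right s t ->
  count_mem W s + count_mem B t <= (count_mem W t + count_mem B s).+1.
Proof.
move=> st /strip_moveP[u [v [r [Es vp Et]]]].
have [n E] := remove_deadE (u ++ W :: v ++ B :: r); rewrite -Et in E.
have E' : (exists2 m, m <= 1 & u ++ W :: v ++ B :: r =
            nseq m W ++ drop_leading W (u ++ W :: v ++ B :: r)).
  case: u Es E {Et} => [|a u] Es _ /=.
    by exists 1 => //; case: v vp {Es} => [|[]].
  case: a Es => Es; first by exists 0.
  by rewrite Es in st.
case: E' => m m1; rewrite E => E'.
move: (congr1 (count_mem W) E') (congr1 (count_mem B) E').
by rewrite Es !count_cat /= !count_cat /= !count_nseq /=; lia.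
Qed.

Lemma split_last_black (s : word) : B \in s ->
  exists u r, s = u ++ B :: r /\ B \notin r.
Proof.
elim: s => // a s IHs; rewrite inE.
case Bs: (B \in s); last by rewrite orbF => /eqP <-; exists [::], s; rewrite Bs.
by have [u [r [-> Br]]] := IHs Bs; exists (a :: u), r.
Qed.

(** The last black stone jumps over all whites behind it and dies at the end.
    The whites that it passes survive thanks to the first black stone, which is
    a different one. *)
Lemma left_move_delta (s : word) : is_strip s -> 1 < count_mem B s ->
  exists2 t, strip_move Left s t
    & count_mem W s + count_mem B t < count_mem W t + count_mem B s.
Proof.
move=> st b2.
have nz : s != [::] by case: s st b2.
have [x Es lx] := strip_cons _ st nz.
have Bx : B \in x by rewrite -has_pred1 has_count; move: b2; rewrite Es /=; lia.
have [u [r [Ex Br]]] := split_last_black _ Bx.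
have [v Er] : exists v, r = rcons v W.
  move: lx; rewrite Ex; case/lastP: r {Ex Br} => [|v c].
    by rewrite last_cat.
  by rewrite last_cat /= last_rcons => ->; exists v.
rewrite Er mem_rcons inE /= in Br.
exists (remove_dead ((B :: u) ++ W :: v ++ [:: B])).
  apply/strip_moveP; exists (B :: u), v, [::]; split=> //.
  by rewrite Es Ex Er -cats1.
have [n] := remove_deadE ((B :: u) ++ W :: v ++ [:: B]).
set t := remove_dead _ => E.
have {E} E : (B :: u) ++ W :: v ++ [:: B] = t ++ nseq n B := E.
(* Without a death at the end, the word would still end with B. *)
have n0 : 0 < n.
  case: n E => // /esym; rewrite cats0 => Et.
  have := is_strip_remove_dead ((B :: u) ++ W :: v ++ [:: B]).
  by rewrite -/t Et /is_strip /= last_cat /= last_cat.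
move: (congr1 (count_mem W) E) (congr1 (count_mem B) E).
rewrite Es Ex Er -cats1 /= !count_cat /= !count_cat !count_nseq /=; lia.
Qed.

Definition thin (s : word) : bool := count_mem B s <= 1.

Lemma thin_cons (s : word) : is_strip s -> thin s -> s != [::] ->
  exists2 x, s = B :: W :: x & count_mem B x = 0.
Proof.
move=> st th nz; have [x Es lx] := strip_cons _ st nz.
move: th lx; rewrite /thin Es {Es}.
by case: x => // -[] x //= th _; exists x => //; move: th; lia.
Qed.

(** In a word BW...W, no white stone other than the first may jump, because Right
    may not pass over whites; the first one arrives at the front and dies. *)
Lemma thin_right (s t : word) : is_strip s -> thin s -> strip_move Right s t ->
  thin t /\ count_mem W s = (count_mem W t).+1.
Proof.
move=> st th /strip_moveP[u [v [r [Es vp Et]]]].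
have u0 : u = [::].
  case: u Es {Et} => // a u Es.
  have nz : s != [::] by rewrite Es.
  have [x Ex _] := strip_cons _ st nz; move: th.
  rewrite /thin Es; case: (etrans (esym Es) Ex) => -> _.
  by rewrite /= count_cat /=; lia.
have v0 : v = [::].
  case: v vp Es {Et} => // -[] // v _ Es.
  by move: th; rewrite /thin Es count_cat /=; lia.
subst u v; have [] := count_remove_dead 1 r; rewrite -[_ ++ _]/(W :: B :: r).
by move: th; rewrite /thin Et Es /=; lia.
Qed.

(** Whites that the black stone leaves behind are at the front and die.  Being
    able to remove one or two of them, Left controls the parity of their
    number. *)
Lemma thin_left (k : nat) (s : word) : is_strip s -> thin s -> s != [::] ->
  k < 2 -> k < count_mem W s ->
  exists t, [/\ strip_move Left s t, thin t
              & count_mem W s = count_mem W t + k.+1].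
Proof.
move=> st th nz k2 kw; have [x Es bx] := thin_cons _ st th nz.
have [y [Ey by0]] : exists y, x = nseq k W ++ y /\ count_mem B y = 0.
  case: k k2 kw => [|[]] // _; first by exists x.
  rewrite Es; case: x bx {Es} => [|[] y] //= by0 _.
  by exists y.
exists (remove_dead (nseq k.+1 W ++ B :: y)).
have [wt bt] := count_remove_dead k.+1 y.
split; last 1 first.
- by rewrite wt Es Ey /= count_cat count_nseq /=; lia.
- apply/strip_moveP; exists [::], (nseq k W), y; split=> //.
    have E z : nseq k W ++ W :: z = W :: nseq k W ++ z by elim: (k) => //= ? ->.
    by rewrite Es Ey /= E.
  by rewrite mem_nseq andbF.
- by rewrite /thin; lia.
Qed.

(** * Sums of strips and the invariant *)

Definition blacks (g : seq word) : nat := count_mem B (flatten g).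
Definition whites (g : seq word) : nat := count_mem W (flatten g).
Definition sum_inv (g : seq word) : nat := sumn (map inv g).

Lemma delta_ge2E (g : seq word) :
  (2 <= delta g)%R = (blacks g + 2 <= whites g).
Proof.
have -> : delta g = ((whites g)%:Z - (blacks g)%:Z)%R.
  rewrite /delta /whites /blacks; elim: g => [|s g IHg].
    by rewrite big_nil.
  by rewrite big_cons IHg /strip_delta /= !count_cat; lia.
by lia.
Qed.

Lemma count_flatten_mid (c : stone) (l : seq word) (s : word) (r : seq word) :
  count_mem c (flatten (l ++ s :: r)) =
  count_mem c (flatten l) + count_mem c s + count_mem c (flatten r).
Proof. by rewrite flatten_cat /= !count_cat addnA. Qed.

Lemma split_has (T : Type) (a : pred T) (g : seq T) : has a g ->
  exists l s r, g = l ++ s :: r /\ a s.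
Proof.
elim: g => // s g IHg /=; case as_ : (a s) => /=; first by exists [::], s, g.
by case/IHg=> l [s' [r [-> a']]]; exists (s :: l), s', r.
Qed.

Lemma has_white_rich (g : seq word) : blacks g < whites g ->
  has (fun s => count_mem B s < count_mem W s) g.
Proof.
rewrite /blacks /whites; elim: g => //= s g IHg; rewrite !count_cat => lt.
by case: ltnP => //= le; apply: IHg; lia.
Qed.

Lemma sum_inv_move (p : player) (g h : seq word) :
  sum_move p g h -> sum_inv h < sum_inv g.
Proof.
case/sum_moveP=> l [s [t [r [-> /inv_move lt ->]]]].
by rewrite /sum_inv !map_cat !sumn_cat /=; lia.
Qed.

Lemma strips_move (p : player) (g h : seq word) :
  sum_move p g h -> all is_strip g -> all is_strip h.
Proof.
case/sum_moveP=> l [s [t [r [-> mv ->]]]].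
case/strip_moveP: mv => u [v [x [_ _ ->]]].
by rewrite !all_cat /= is_strip_remove_dead => /and3P[-> _ ->].
Qed.

(** [good_left] and [good_right] gather the positions that the strategy meets
    with Left, respectively Right, to move. *)
Definition good_left (g : seq word) : bool :=
  (blacks g < whites g) || all thin g && ~~ odd (whites g).
Definition good_right (g : seq word) : bool :=
  (blacks g + 2 <= whites g) || all thin g && odd (whites g).

(** Right can lower delta by at most one, and cannot choose the parity of the
    number of whites on thin strips: it always flips. *)
Lemma good_right_step (g h : seq word) : all is_strip g ->
  good_right g -> sum_move Right g h -> good_left h.
Proof.
move=> st gd /sum_moveP[l [s [t [r [Eg mv Eh]]]]]; move: st gd.
rewrite /good_right /good_left /blacks /whites Eg Eh.
rewrite !count_flatten_mid !all_cat /=.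
case/and3P=> _ st_s _ /orP[dl | /andP[/and3P[thl ths thr] ow]]; apply/orP.
  by left; have /= := right_move_delta _ _ st_s mv; lia.
have [tht /= E] := thin_right _ _ st_s ths mv.
by right; rewrite thl tht thr; lia.
Qed.

(** Left raises delta if some strip is not thin, and otherwise makes the number
    of whites odd. *)
Lemma good_left_step (g : seq word) : all is_strip g -> good_left g ->
  (forall h, ~ sum_move Left g h) \/
  exists2 h, sum_move Left g h & good_right h.
Proof.
move=> st gd; case thg: (all thin g); last first.
  have dl : blacks g < whites g by move: gd; rewrite /good_left thg orbF.
  move/negbT: thg; rewrite -has_predC => /split_has[l [s [r [Eg]]]] /=.
  rewrite /thin -ltnNge => b2.
  have st_s : is_strip s by move: st; rewrite Eg all_cat /= => /and3P[].
  have [t mv dt] := left_move_delta _ st_s b2; right; exists (l ++ t :: r).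
    by apply/sum_moveP; exists l, s, t, r.
  move: dl; rewrite /good_right /blacks /whites Eg !count_flatten_mid => dl.
  by apply/orP; left; lia.
(* Removing [k.+1] whites, where [k] has the parity of their total number,
   leaves an odd total. *)
have play k l s r : g = l ++ s :: r -> s != [::] -> k < 2 ->
    k < count_mem W s -> odd (whites g) = odd k ->
    exists2 h, sum_move Left g h & good_right h.
  move=> Eg nz k2 kw ow; move: (st) (thg); rewrite Eg !all_cat /=.
  case/and3P=> _ st_s _ /and3P[thl ths thr].
  have [t [mv tht E]] := thin_left k _ st_s ths nz k2 kw.
  exists (l ++ t :: r); first by apply/sum_moveP; exists l, s, t, r.
  apply/orP; right; rewrite all_cat /= thl tht thr /=.
  by move: ow; rewrite Eg /whites !count_flatten_mid; lia.
case ow: (odd (whites g)).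
  have dl : blacks g < whites g by move: gd; rewrite /good_left ow andbF orbF.
  have /split_has[l [s [r [Eg lt]]]] := has_white_rich _ dl; right.
  have nz : s != [::] by case: (s) lt.
  have [st_s ths] : is_strip s /\ thin s.
    by move: st thg; rewrite Eg !all_cat /= => /and3P[_ -> _] /and3P[_ -> _].
  apply: (play 1 l s r) => //; have [x Es _] := thin_cons _ st_s ths nz.
  by apply: leq_ltn_trans lt; rewrite Es.
case: (boolP (has (predC1 [::]) g)) => [/split_has[l [s [r [Eg nz]]]] | dead].
  right; apply: (play 0 l s r) => //.
  have [st_s ths] : is_strip s /\ thin s.
    by move: st thg; rewrite Eg !all_cat /= => /and3P[_ -> _] /and3P[_ -> _].
  by have [x -> _] := thin_cons _ st_s ths nz.
left=> h /sum_moveP[l [s [t [r [Eg /strip_moveP[u [v [x [Es _ _]]]] _]]]]].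
move: dead; rewrite Eg has_cat /= Es negb_or => /andP[_].
by case: (u).
Qed.

(** This excludes the case where Right, unable to move, would be the winner. *)
Lemma good_right_can_move (g : seq word) : all is_strip g -> good_right g ->
  exists h, sum_move Right g h.
Proof.
move=> st gd.
have: has (predC1 [::]) g.
  have : 0 < whites g by move: gd; rewrite /good_right; lia.
  rewrite /whites; apply: contraLR; rewrite -all_predC => /allP g0.
  rewrite -eqn0Ngt -leqn0 leqNgt -has_count has_pred1.
  apply/flattenP=> -[s /g0 /=]; rewrite negbK => /eqP -> //.
case/split_has=> l [s [r [Eg nz]]].
have st_s : is_strip s by move: st; rewrite Eg all_cat /= => /and3P[].
have [t mv] := strip_can_move Right _ st_s nz.
by exists (l ++ t :: r); apply/sum_moveP; exists l, s, t, r.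
Qed.

Lemma good_wins (g : seq word) : all is_strip g ->
  (good_left g -> misere_first sum_move Left g) /\
  (good_right g -> misere_second sum_move Left g).
Proof.
have [n] := ubnP (sum_inv g); elim: n g => // n IHn g lt_n st.
have IH p h : sum_move p g h ->
    (good_left h -> misere_first sum_move Left h) /\
    (good_right h -> misere_second sum_move Left h).
  move=> mv; apply: IHn (strips_move _ _ _ mv st).
  by have := sum_inv_move _ _ _ mv; lia.
split=> gd.
  have [stuck | [h mv gh]] := good_left_step _ st gd; first exact: misere_stuck.
  by apply: misere_move (mv) _; have [_] := IH _ _ mv; apply.
have [h mv] := good_right_can_move _ st gd.
apply: (@misere_reply _ sum_move Left g h mv) => h' mv'.
by have [+ _] := IH _ _ mv'; apply; apply: good_right_step mv'.
Qed.

Theorem theorem21 (g : seq word) (g_strips : all is_strip g)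
    (delta_ge2 : (2 <= delta g)%R) :
  misere_first sum_move Left g /\ misere_second sum_move Left g.
Proof.
have [wl wr] := good_wins g g_strips; rewrite delta_ge2E in delta_ge2.
split; [apply: wl | apply: wr]; apply/orP; left; lia.
Qed.
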